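(* Let $\mathbb K$ be a commutative semiring, $N\ge1$, $\mathcal C=\bigcup_{n,m\ge1}\mathcal C_{n,m}$ a graded set of chips (each $\mathcal C_{n,m}$ finite) and $\mu:\mathcal Circ(\mathcal C)\to\mathbb K(N)$ a multilinear representation. For every circuit $\mathfrak p\in\mathcal Circ(\mathcal C)_{m,n}$ and all $I\in[N]^m$, $J\in[N]^n$, the entry of $\mu(\mathfrak p)$ with upper index $I$ and lower index $J$ is $$\mu(\mathfrak p)^I_J=\sum_{\mathfrak q}\tilde\mu(\mathfrak q),$$ where the sum is over the paths $\mathfrak q\in\mathcal Paths(\mathcal C,N)$ such that $u(\mathfrak q)=\mathfrak p$, $\mathtt{Out}(\mathfrak q)=I$ and $\mathtt{In}(\mathfrak q)=J$.
   Context: $[N]=\{1,\dots,N\}$. PRO: a bigraded set $\mathcal P=\bigcup_{m,n\in\mathbb N}\mathcal P_{m,n}$ with associative operations $\leftrightarrow:\mathcal P_{m,n}\times\mathcal P_{m',n'}\to\mathcal P_{m+m',n+n'}$ and $\updownarrow:\mathcal P_{m,n}\times\mathcal P_{n,p}\to\mathcal P_{m,p}$ satisfying the interchange law $(p\updownarrow q)\leftrightarrow(p'\updownarrow q')=(p\leftrightarrow p')\updownarrow(q\leftrightarrow q')$, with graded vertical units $Id_n\in\mathcal P_{n,n}$ ($Id_n=Id_1^{\leftrightarrow n}$ for $n\ge1$) and a two-sided unit $Id_0$ for $\leftrightarrow$. Morphisms of PROs are graded maps preserving $\leftrightarrow$, $\updownarrow$ and all $Id_n$. Circuits: an element of $\mathcal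 C_{n,m}$ is a chip with $n$ outputs (top) and $m$ inputs (bottom). Circuits are built from the empty circuit $\oslash=Id_0$, the wire $Id_1$ and chips by juxtaposition $\leftrightarrow$ and connection $\updownarrow$ (joining the $i$-th input of the upper circuit to the $i$-th output of the lower one); $\mathcal Circ(\mathcal C)$ is (isomorphic to) the free PRO on $\mathcal C$. $\mathcal Circ(\mathcal C)_{m,n}$ is the set of circuits with $m$ outputs and $n$ inputs. Hypermatrices: $\mathbb K(N)=\bigcup_{p,q}\mathbb K(N;p,q)$, $\mathbb K(N;p,q)$ being the set of families $A=(A^I_J)_{I\in[N]^p,J\in[N]^q}$ in $\mathbb K$, is a PRO with $(A\leftrightarrow B)^{II'}_{JJ'}=A^I_JB^{I'}_{J'}$ and $(A\updownarrow B)^I_J=\sum_KA^I_KB^K_J$. A multilinear representation is a morphism of PROs into $\mathbb K(N)$. Paths: $\mathcal Paths(\mathcal C,N)$ is the set of circuits whose outputs, inputs and connections are labelled by elements of $[N]$. Formally, paths are built inductively from: the empty path $\oslash$; labelled wires (one for each $i\in[N]$, with output label $i$ and input label $i$); labelled chips $(I;\mathfrak c;J)$ with $\mathfrak c\in\mathcal C_{n,m}$, output labels $I\in[N]^n$ and input labels $J\in[N]^m$; juxtaposition $\mathfrak q\leftrightarrow\mathfrak q'$; and connection $\mathfrak q\updownarrow\mathfrak q'$, defined only when the sequence of input labels of $\mathfrak q$ equals the sequence of output labels of $\mathfrak q'$ (each matched input/output pair being joined by a wire carrying their common label). These satisfy the same rules as for circuits (associativities, interchange law, labelled wires are units for $\updownarrow$,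 $\oslash$ is a unit for $\leftrightarrow$), and identifications are only those coming from these rules. $\mathtt{Out}(\mathfrak q)$ and $\mathtt{In}(\mathfrak q)$ are the sequences of labels of the outputs and inputs of $\mathfrak q$. The map $u:\mathcal Paths(\mathcal C,N)\to\mathcal Circ(\mathcal C)$ forgets all labels. The map $\tilde\mu:\mathcal Paths(\mathcal C,N)\to\mathbb K$ is defined by $\tilde\mu((I;\mathfrak c;J))=\mu(\mathfrak c)^I_J$ for $\mathfrak c\in\mathcal C$; $\tilde\mu(\mathfrak p\updownarrow\mathfrak q)=\tilde\mu(\mathfrak p)\tilde\mu(\mathfrak q)$ when $\mathtt{Out}(\mathfrak q)=\mathtt{In}(\mathfrak p)$; $\tilde\mu(\mathfrak p\leftrightarrow\mathfrak p')=\tilde\mu(\mathfrak p)\tilde\mu(\mathfrak p')$; and $\tilde\mu=1$ on each labelled wire and on the empty path. *)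

(* Defs.v *)
From HB Require Import structures.
From mathcomp Require Import all_boot all_algebra.
From mathcomp Require Import boolp classical_sets functions cardinality fsbigop.

Set Implicit Arguments.
Unset Strict Implicit.
Unset Printing Implicit Defensive.

Import GRing.Theory.

(* Transport along equalities of degrees; [castmx] plays this role for
   matrices. *)
Definition cast_deg (P : nat -> nat -> Type) m n m' n'
    (em : m = m') (en : n = n') (p : P m n) : P m' n' :=
  match em in _ = a, en in _ = b return P a b with erefl, erefl => p end.

Record PRO := MkPRO {
  pro_sort :> nat -> nat -> Type;
  jux : forall m n m' n',
    pro_sort m n -> pro_sort m' n' -> pro_sort (m + m') (n + n');
  conn : forall m n p, pro_sort m n -> pro_sort n p -> pro_sort m p;
  idn : forall n, pro_sort n n;
  juxA : forall m1 n1 m2 n2 m3 n3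
    (p : pro_sort m1 n1) (q : pro_sort m2 n2) (r : pro_sort m3 n3),
    cast_deg (addnA m1 m2 m3) (addnA n1 n2 n3) (jux p (jux q r)) =
    jux (jux p q) r;
  connA : forall m n k l
    (p : pro_sort m n) (q : pro_sort n k) (r : pro_sort k l),
    conn p (conn q r) = conn (conn p q) r;
  interchange : forall m n k m' n' k'
    (p : pro_sort m n) (q : pro_sort n k)
    (p' : pro_sort m' n') (q' : pro_sort n' k'),
    jux (conn p q) (conn p' q') = conn (jux p p') (jux q q');
  conn_idl : forall m n (p : pro_sort m n), conn (idn m) p = p;
  conn_idr : forall m n (p : pro_sort m n), conn p (idn n) = p;
  (* iterating this law gives Id_n = Id_1 <-> ... <-> Id_1 *)
  idnS : forall n, idn n.+1 = jux (idn 1) (idn n);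
  jux_id0l : forall m n (p : pro_sort m n), jux (idn 0) p = p;
  jux_id0r : forall m n (p : pro_sort m n),
    cast_deg (addn0 m) (addn0 n) (jux p (idn 0)) = p
}.

Record PRO_morphism (P Q : PRO) := MkPROMorphism {
  pro_fun :> forall m n, P m n -> Q m n;
  pro_fun_jux : forall m n m' n' (p : P m n) (q : P m' n'),
    pro_fun (jux p q) = jux (pro_fun p) (pro_fun q);
  pro_fun_conn : forall m n k (p : P m n) (q : P n k),
    pro_fun (conn p q) = conn (pro_fun p) (pro_fun q);
  pro_fun_id : forall n, pro_fun (idn P n) = idn Q n
}.

(* Terms denoting circuits; the first degree counts the outputs, the second
   one the inputs. *)
Inductive cterm (C : nat -> nat -> finType) : nat -> nat -> Type :=
| CEmpty : cterm C 0 0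
| CWire : cterm C 1 1
| CChip n m : C n m -> cterm C n m
| CJux m n m' n' : cterm C m n -> cterm C m' n' -> cterm C (m + m') (n + n')
| CConn m n k : cterm C m n -> cterm C n k -> cterm C m k.

Arguments CEmpty {C}.
Arguments CWire {C}.

Fixpoint cid (C : nat -> nat -> finType) n : cterm C n n :=
  match n return cterm C n n with
  | 0 => CEmpty
  | n'.+1 => CJux CWire (cid C n')
  end.

(* The congruence generated by the axioms of PROs. It relates terms of a
   priori different degrees, so that no transport occurs in the rules;
   [ceq_deg] below shows that related terms have the same degrees. *)
Inductive ceq (C : nat -> nat -> finType) :
  forall m n m' n', cterm C m n -> cterm C m' n' -> Prop :=
| ceq_refl m n (s : cterm C m n) : ceq s s
| ceq_sym m n m' n' (s : cterm C m n) (t : cterm C m' n') :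
    ceq s t -> ceq t s
| ceq_trans m n m' n' m'' n''
    (s : cterm C m n) (t : cterm C m' n') (r : cterm C m'' n'') :
    ceq s t -> ceq t r -> ceq s r
| ceq_jux m1 n1 m1' n1' m2 n2 m2' n2'
    (s : cterm C m1 n1) (s' : cterm C m1' n1')
    (t : cterm C m2 n2) (t' : cterm C m2' n2') :
    ceq s s' -> ceq t t' -> ceq (CJux s t) (CJux s' t')
| ceq_conn m n k m' n' k'
    (s : cterm C m n) (s' : cterm C m' n')
    (t : cterm C n k) (t' : cterm C n' k') :
    ceq s s' -> ceq t t' -> ceq (CConn s t) (CConn s' t')
| ceq_juxA m1 n1 m2 n2 m3 n3
    (s : cterm C m1 n1) (t : cterm C m2 n2) (r : cterm C m3 n3) :
    ceq (CJux s (CJux t r)) (CJux (CJux s t) r)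
| ceq_connA m n k l (s : cterm C m n) (t : cterm C n k) (r : cterm C k l) :
    ceq (CConn s (CConn t r)) (CConn (CConn s t) r)
| ceq_interchange m n k m' n' k'
    (s : cterm C m n) (t : cterm C n k)
    (s' : cterm C m' n') (t' : cterm C n' k') :
    ceq (CJux (CConn s t) (CConn s' t')) (CConn (CJux s s') (CJux t t'))
| ceq_idl m n (s : cterm C m n) : ceq (CConn (cid C m) s) s
| ceq_idr m n (s : cterm C m n) : ceq (CConn s (cid C n)) s
| ceq_id0l m n (s : cterm C m n) : ceq (CJux CEmpty s) s
| ceq_id0r m n (s : cterm C m n) : ceq (CJux s CEmpty) s.

Lemma ceq_deg C m n m' n' (s : cterm C m n) (t : cterm C m' n') :
  ceq s t -> m = m' /\ n = n'.
Proof.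
elim=> //=.
- by move=> ? ? ? ? ? ? _ [-> ->].
- by move=> ? ? ? ? ? ? ? ? ? _ [-> ->] _ [-> ->].
- by move=> ? ? ? ? ? ? ? ? ? ? ? ? _ [-> ->] _ [-> ->].
- by move=> ? ? ? ? ? ? ? ? ? ? _ [-> _] _ [_ ->].
- by move=> *; rewrite !addnA.
- by move=> *; rewrite !addn0.
Qed.

HB.instance Definition _ C m n := gen_eqMixin (cterm C m n).
HB.instance Definition _ C m n := gen_choiceMixin (cterm C m n).

Section CircuitQuotient.
Local Open Scope quotient_scope.
Variables (C : nat -> nat -> finType) (m n : nat).

Definition ceqb (s t : cterm C m n) : bool := `[< ceq s t >].

Lemma ceqb_refl : reflexive ceqb.
Proof. by move=> s; apply/asboolP; exact: ceq_refl. Qed.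

Lemma ceqb_sym : symmetric ceqb.
Proof. by move=> s t; apply/asboolP/asboolP; exact: ceq_sym. Qed.

Lemma ceqb_trans : transitive ceqb.
Proof.
by move=> t s r /asboolP st /asboolP tr; apply/asboolP; exact: ceq_trans st tr.
Qed.

Canonical ceq_equiv := EquivRel ceqb ceqb_refl ceqb_sym ceqb_trans.

Definition circuit := {eq_quot ceqb}.
HB.instance Definition _ := Choice.on circuit.

Definition circuit_of (t : cterm C m n) : circuit := \pi_circuit t.
Definition circuit_repr (p : circuit) : cterm C m n := repr p.

Lemma circuit_reprK p : circuit_of (circuit_repr p) = p.
Proof. exact: reprK. Qed.

Lemma circuit_ofP s t : circuit_of s = circuit_of t <-> ceq s t.
Proof. by split=> [/eqmodP/asboolP|st]; last by apply/eqmodP/asboolP. Qed.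

Lemma circuit_reprP t : ceq (circuit_repr (circuit_of t)) t.
Proof. by apply/circuit_ofP; rewrite circuit_reprK. Qed.

End CircuitQuotient.

Definition circ_jux C m n m' n' (p : circuit C m n) (q : circuit C m' n') :
    circuit C (m + m') (n + n') :=
  circuit_of (CJux (circuit_repr p) (circuit_repr q)).

Definition circ_conn C m n k (p : circuit C m n) (q : circuit C n k) :
    circuit C m k :=
  circuit_of (CConn (circuit_repr p) (circuit_repr q)).

Definition circ_chip (C : nat -> nat -> finType) n m (c : C n m) :
    circuit C n m :=
  circuit_of (CChip c).

Lemma circ_juxE C m n m' n' (s : cterm C m n) (t : cterm C m' n') :
  circ_jux (circuit_of s) (circuit_of t) = circuit_of (CJux s t).
Proof. by apply/circuit_ofP/ceq_jux; exact: circuit_reprP. Qed.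

Lemma circ_connE C m n k (s : cterm C m n) (t : cterm C n k) :
  circ_conn (circuit_of s) (circuit_of t) = circuit_of (CConn s t).
Proof. by apply/circuit_ofP/ceq_conn; exact: circuit_reprP. Qed.

Lemma cast_circuit_of C m n m' n' (em : m = m') (en : n = n')
    (s : cterm C m n) (t : cterm C m' n') :
  ceq s t ->
  cast_deg em en (circuit_of s : circuit C m n) = circuit_of t.
Proof. by move=> st; subst m' n'; apply/circuit_ofP. Qed.

Section CircuitPRO.
Variable C : nat -> nat -> finType.

Lemma circ_juxA m1 n1 m2 n2 m3 n3
    (p : circuit C m1 n1) (q : circuit C m2 n2) (r : circuit C m3 n3) :
  cast_deg (addnA m1 m2 m3) (addnA n1 n2 n3) (circ_jux p (circ_jux q r)) =
  circ_jux (circ_jux p q) r.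
Proof.
rewrite -(circuit_reprK p) -(circuit_reprK q) -(circuit_reprK r) !circ_juxE.
exact/cast_circuit_of/ceq_juxA.
Qed.

Lemma circ_connA m n k l
    (p : circuit C m n) (q : circuit C n k) (r : circuit C k l) :
  circ_conn p (circ_conn q r) = circ_conn (circ_conn p q) r.
Proof.
rewrite -(circuit_reprK p) -(circuit_reprK q) -(circuit_reprK r) !circ_connE.
exact/circuit_ofP/ceq_connA.
Qed.

Lemma circ_interchange m n k m' n' k'
    (p : circuit C m n) (q : circuit C n k)
    (p' : circuit C m' n') (q' : circuit C n' k') :
  circ_jux (circ_conn p q) (circ_conn p' q') =
  circ_conn (circ_jux p p') (circ_jux q q').
Proof.
rewrite -(circuit_reprK p) -(circuit_reprK q) -(circuit_reprK p').
rewrite -(circuit_reprK q') (circ_connE (circuit_repr p)).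
rewrite (circ_connE (circuit_repr p')) !circ_juxE circ_connE.
exact/circuit_ofP/ceq_interchange.
Qed.

Lemma circ_conn_idl m n (p : circuit C m n) :
  circ_conn (circuit_of (cid C m)) p = p.
Proof.
by rewrite -(circuit_reprK p) circ_connE; apply/circuit_ofP/ceq_idl.
Qed.

Lemma circ_conn_idr m n (p : circuit C m n) :
  circ_conn p (circuit_of (cid C n)) = p.
Proof.
by rewrite -(circuit_reprK p) circ_connE; apply/circuit_ofP/ceq_idr.
Qed.

Lemma circ_idnS n :
  circuit_of (cid C n.+1) =
  circ_jux (circuit_of (cid C 1)) (circuit_of (cid C n)).
Proof.
rewrite circ_juxE; apply/circuit_ofP.
apply: (@ceq_jux C 1 1 1 1 n n n n CWire (cid C 1)); last exact: ceq_refl.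
exact/ceq_sym/(@ceq_id0r C 1 1).
Qed.

Lemma circ_jux_id0l m n (p : circuit C m n) :
  circ_jux (circuit_of (cid C 0)) p = p.
Proof.
by rewrite -(circuit_reprK p) circ_juxE; apply/circuit_ofP/ceq_id0l.
Qed.

Lemma circ_jux_id0r m n (p : circuit C m n) :
  cast_deg (addn0 m) (addn0 n) (circ_jux p (circuit_of (cid C 0))) = p.
Proof.
by rewrite -(circuit_reprK p) circ_juxE; apply/cast_circuit_of/ceq_id0r.
Qed.

Definition Circ : PRO := @MkPRO (circuit C) (@circ_jux C) (@circ_conn C)
  (fun n => circuit_of (cid C n)) circ_juxA circ_connA circ_interchange
  circ_conn_idl circ_conn_idr circ_idnS circ_jux_id0l circ_jux_id0r.

Lemma circ_wire : circuit_of CWire = idn Circ 1.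
Proof. exact/circuit_ofP/ceq_sym/(@ceq_id0r C 1 1). Qed.

End CircuitPRO.

Section Parts.
Variables (T : Type) (m n : nat).

Lemma size_ltuple (I : (m + n).-tuple T) : size (take m I) == m.
Proof. by rewrite size_takel // size_tuple leq_addr. Qed.

Lemma size_rtuple (I : (m + n).-tuple T) : size (drop m I) == n.
Proof. by rewrite size_drop size_tuple addKn. Qed.

Definition ltuple I : m.-tuple T := Tuple (size_ltuple I).
Definition rtuple I : n.-tuple T := Tuple (size_rtuple I).

Lemma ltuple_cat (I : m.-tuple T) (J : n.-tuple T) :
  ltuple (cat_tuple I J) = I.
Proof. by apply: val_inj; rewrite /= take_size_cat ?size_tuple. Qed.

Lemma rtuple_cat (I : m.-tuple T) (J : n.-tuple T) :
  rtuple (cat_tuple I J) = J.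
Proof. by apply: val_inj; rewrite /= drop_size_cat ?size_tuple. Qed.

Lemma cat_lrtuple (I : (m + n).-tuple T) :
  cat_tuple (ltuple I) (rtuple I) = I.
Proof. by apply: val_inj; rewrite /= cat_take_drop. Qed.

End Parts.

Section Hypermatrices.
Local Open Scope ring_scope.
Variables (K : comPzSemiRingType) (N : nat).

(* The index set [N] = {1, ..., N} is represented by 'I_N; [A I J] is the
   entry with upper index I and lower index J. *)
Definition hypermx p q := {ffun p.-tuple 'I_N -> {ffun q.-tuple 'I_N -> K}}.

Definition hypermx_jux m n m' n' (A : hypermx m n) (B : hypermx m' n') :
    hypermx (m + m') (n + n') :=
  [ffun I => [ffun J =>
    A (ltuple I) (ltuple J) * B (rtuple I) (rtuple J)]].

Definition hypermx_conn m n p (A : hypermx m n) (B : hypermx n p) :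
    hypermx m p :=
  [ffun I => [ffun J => \sum_(L : n.-tuple 'I_N) A I L * B L J]].

Definition hypermx_id n : hypermx n n := [ffun I => [ffun J => (I == J)%:R]].

Lemma hypermx_juxE m n m' n' (A : hypermx m n) (B : hypermx m' n')
    (I : m.-tuple 'I_N) (I' : m'.-tuple 'I_N)
    (J : n.-tuple 'I_N) (J' : n'.-tuple 'I_N) :
  hypermx_jux A B (cat_tuple I I') (cat_tuple J J') = A I J * B I' J'.
Proof. by rewrite !ffunE !ltuple_cat !rtuple_cat. Qed.

Lemma hypermxP m n (A B : hypermx m n) : (forall I J, A I J = B I J) -> A = B.
Proof. by move=> AB; apply/ffunP => I; apply/ffunP => J. Qed.

Lemma cast_hypermxE m n m' n' (em : m = m') (en : n = n') (A : hypermx m n)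
    (I : m'.-tuple 'I_N) (J : n'.-tuple 'I_N) :
  cast_deg em en A I J = A (tcast (esym em) I) (tcast (esym en) J).
Proof. by subst m' n'. Qed.

Lemma hypermx_juxA m1 n1 m2 n2 m3 n3
    (A : hypermx m1 n1) (B : hypermx m2 n2) (D : hypermx m3 n3) :
  cast_deg (addnA m1 m2 m3) (addnA n1 n2 n3)
    (hypermx_jux A (hypermx_jux B D)) =
  hypermx_jux (hypermx_jux A B) D.
Proof.
have ll a b c (I : (a + b + c).-tuple 'I_N) :
    ltuple (tcast (esym (addnA a b c)) I) = ltuple (ltuple I).
  by apply: val_inj; rewrite /= val_tcast take_takel // leq_addr.
have rl a b c (I : (a + b + c).-tuple 'I_N) :
    ltuple (rtuple (tcast (esym (addnA a b c)) I)) = rtuple (ltuple I).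
  by apply: val_inj; rewrite /= val_tcast take_drop addnC.
have rr a b c (I : (a + b + c).-tuple 'I_N) :
    rtuple (rtuple (tcast (esym (addnA a b c)) I)) = rtuple I.
  by apply: val_inj; rewrite /= val_tcast drop_drop addnC.
by apply: hypermxP => I J; rewrite cast_hypermxE !ffunE mulrA !ll !rl !rr.
Qed.

Lemma hypermx_connA m n k l
    (A : hypermx m n) (B : hypermx n k) (D : hypermx k l) :
  hypermx_conn A (hypermx_conn B D) = hypermx_conn (hypermx_conn A B) D.
Proof.
apply: hypermxP => I J; rewrite !ffunE.
under eq_bigr do rewrite !ffunE mulr_sumr.
rewrite exchange_big; apply: eq_bigr => L _; rewrite !ffunE mulr_suml.
by apply: eq_bigr => M _; rewrite mulrA.
Qed.

Lemma hypermx_interchange m n k m' n' k'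
    (A : hypermx m n) (B : hypermx n k)
    (A' : hypermx m' n') (B' : hypermx n' k') :
  hypermx_jux (hypermx_conn A B) (hypermx_conn A' B') =
  hypermx_conn (hypermx_jux A A') (hypermx_jux B B').
Proof.
apply: hypermxP => I J; rewrite !ffunE big_distrlr /= pair_big /=.
rewrite (reindex (fun L : (n + n').-tuple 'I_N => (ltuple L, rtuple L))) /=.
  by apply: eq_bigr => L _; rewrite !ffunE mulrACA.
exists (fun L => cat_tuple L.1 L.2) => [L _|[L L'] _] /=.
  exact: cat_lrtuple.
by rewrite ltuple_cat rtuple_cat.
Qed.

Lemma hypermx_conn_idl m n (A : hypermx m n) :
  hypermx_conn (hypermx_id m) A = A.
Proof.
apply: hypermxP => I J; rewrite !ffunE (bigD1 I) //= !ffunE eqxx mul1r.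
by rewrite big1 ?addr0 // => L LI; rewrite !ffunE eq_sym (negbTE LI) mul0r.
Qed.

Lemma hypermx_conn_idr m n (A : hypermx m n) :
  hypermx_conn A (hypermx_id n) = A.
Proof.
apply: hypermxP => I J; rewrite !ffunE (bigD1 J) //= !ffunE eqxx mulr1.
by rewrite big1 ?addr0 // => L LJ; rewrite !ffunE (negbTE LJ) mulr0.
Qed.

Lemma hypermx_idnS n :
  hypermx_id n.+1 = hypermx_jux (hypermx_id 1) (hypermx_id n).
Proof.
apply: hypermxP => I J; rewrite !ffunE -natrM mulnb; congr (nat_of_bool _)%:R.
by rewrite -!val_eqE /= -eqseq_cat ?cat_take_drop // !size_takel ?size_tuple.
Qed.

Lemma hypermx_jux_id0l m n (A : hypermx m n) :
  hypermx_jux (hypermx_id 0) A = A.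
Proof.
apply: hypermxP => I J; rewrite !ffunE.
have -> : ltuple I = ltuple J :> 0.-tuple _ by apply: val_inj; rewrite /= !take0.
rewrite eqxx mul1r.
by congr (A _ _); apply: val_inj; rewrite /= drop0.
Qed.

Lemma hypermx_jux_id0r m n (A : hypermx m n) :
  cast_deg (addn0 m) (addn0 n) (hypermx_jux A (hypermx_id 0)) = A.
Proof.
apply: hypermxP => I J; rewrite cast_hypermxE !ffunE.
set I0 := tcast _ I; set J0 := tcast _ J.
have -> : rtuple I0 = rtuple J0 :> 0.-tuple _.
  by rewrite (tuple0 (rtuple I0)) (tuple0 (rtuple J0)).
rewrite eqxx mulr1 /I0 /J0.
by congr (A _ _); apply: val_inj; rewrite /= val_tcast take_oversize ?size_tuple.
Qed.

Definition Hypermx : PRO := @MkPRO hypermx hypermx_jux hypermx_conn hypermx_id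
  hypermx_juxA hypermx_connA hypermx_interchange hypermx_conn_idl
  hypermx_conn_idr hypermx_idnS hypermx_jux_id0l hypermx_jux_id0r.

End Hypermatrices.

(* Terms denoting paths, indexed by their output and input labels. The typing
   of [PConn] expresses that a connection is only defined when the labels
   match. *)
Inductive pterm (C : nat -> nat -> finType) (N : nat) :
  forall m n, m.-tuple 'I_N -> n.-tuple 'I_N -> Type :=
| PEmpty : pterm C [tuple] [tuple]
| PWire (i : 'I_N) : pterm C [tuple i] [tuple i]
| PChip n m (I : n.-tuple 'I_N) (c : C n m) (J : m.-tuple 'I_N) : pterm C I J
| PJux m n m' n' (I : m.-tuple 'I_N) (J : n.-tuple 'I_N)
    (I' : m'.-tuple 'I_N) (J' : n'.-tuple 'I_N) :
    pterm C I J -> pterm C I' J' ->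
    pterm C (cat_tuple I I') (cat_tuple J J')
| PConn m n k (I : m.-tuple 'I_N) (L : n.-tuple 'I_N) (J : k.-tuple 'I_N) :
    pterm C I L -> pterm C L J -> pterm C I J.

Arguments PEmpty {C N}.
Arguments PWire {C N} i.

(* [pwires w]: the term [w] is a (possibly empty) juxtaposition of labelled
   wires, that is, the vertical unit on its sequence of labels. *)
Inductive pwires (C : nat -> nat -> finType) (N : nat) :
  forall n (I : n.-tuple 'I_N), pterm C I I -> Prop :=
| pwires0 : pwires PEmpty
| pwiresS (i : 'I_N) n (I : n.-tuple 'I_N) (w : pterm C I I) :
    pwires w -> pwires (PJux (PWire i) w).

(* The congruence generated by the same rules as for circuits. *)
Inductive peq (C : nat -> nat -> finType) (N : nat) :
  forall m n m' n' (I : m.-tuple 'I_N) (J : n.-tuple 'I_N)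
    (I' : m'.-tuple 'I_N) (J' : n'.-tuple 'I_N),
    pterm C I J -> pterm C I' J' -> Prop :=
| peq_refl m n (I : m.-tuple 'I_N) (J : n.-tuple 'I_N) (s : pterm C I J) :
    peq s s
| peq_sym m n m' n' (I : m.-tuple 'I_N) (J : n.-tuple 'I_N)
    (I' : m'.-tuple 'I_N) (J' : n'.-tuple 'I_N)
    (s : pterm C I J) (t : pterm C I' J') :
    peq s t -> peq t s
| peq_trans m n m' n' m'' n'' (I : m.-tuple 'I_N) (J : n.-tuple 'I_N)
    (I' : m'.-tuple 'I_N) (J' : n'.-tuple 'I_N)
    (I'' : m''.-tuple 'I_N) (J'' : n''.-tuple 'I_N)
    (s : pterm C I J) (t : pterm C I' J') (r : pterm C I'' J'') :
    peq s t -> peq t r -> peq s r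
| peq_jux m1 n1 m1' n1' m2 n2 m2' n2'
    (I1 : m1.-tuple 'I_N) (J1 : n1.-tuple 'I_N)
    (I1' : m1'.-tuple 'I_N) (J1' : n1'.-tuple 'I_N)
    (I2 : m2.-tuple 'I_N) (J2 : n2.-tuple 'I_N)
    (I2' : m2'.-tuple 'I_N) (J2' : n2'.-tuple 'I_N)
    (s : pterm C I1 J1) (s' : pterm C I1' J1')
    (t : pterm C I2 J2) (t' : pterm C I2' J2') :
    peq s s' -> peq t t' -> peq (PJux s t) (PJux s' t')
| peq_conn m n k m' n' k'
    (I : m.-tuple 'I_N) (L : n.-tuple 'I_N) (J : k.-tuple 'I_N)
    (I' : m'.-tuple 'I_N) (L' : n'.-tuple 'I_N) (J' : k'.-tuple 'I_N)
    (s : pterm C I L) (s' : pterm C I' L')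
    (t : pterm C L J) (t' : pterm C L' J') :
    peq s s' -> peq t t' -> peq (PConn s t) (PConn s' t')
| peq_juxA m1 n1 m2 n2 m3 n3
    (I1 : m1.-tuple 'I_N) (J1 : n1.-tuple 'I_N)
    (I2 : m2.-tuple 'I_N) (J2 : n2.-tuple 'I_N)
    (I3 : m3.-tuple 'I_N) (J3 : n3.-tuple 'I_N)
    (s : pterm C I1 J1) (t : pterm C I2 J2) (r : pterm C I3 J3) :
    peq (PJux s (PJux t r)) (PJux (PJux s t) r)
| peq_connA m n k l (I : m.-tuple 'I_N) (L : n.-tuple 'I_N)
    (M : k.-tuple 'I_N) (J : l.-tuple 'I_N)
    (s : pterm C I L) (t : pterm C L M) (r : pterm C M J) :
    peq (PConn s (PConn t r)) (PConn (PConn s t) r)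
| peq_interchange m n k m' n' k'
    (I : m.-tuple 'I_N) (L : n.-tuple 'I_N) (J : k.-tuple 'I_N)
    (I' : m'.-tuple 'I_N) (L' : n'.-tuple 'I_N) (J' : k'.-tuple 'I_N)
    (s : pterm C I L) (t : pterm C L J)
    (s' : pterm C I' L') (t' : pterm C L' J') :
    peq (PJux (PConn s t) (PConn s' t')) (PConn (PJux s s') (PJux t t'))
| peq_idl m n (I : m.-tuple 'I_N) (J : n.-tuple 'I_N)
    (w : pterm C I I) (s : pterm C I J) :
    pwires w -> peq (PConn w s) s
| peq_idr m n (I : m.-tuple 'I_N) (J : n.-tuple 'I_N)
    (s : pterm C I J) (w : pterm C J J) :
    pwires w -> peq (PConn s w) s
| peq_id0l m n (I : m.-tuple 'I_N) (J : n.-tuple 'I_N) (s : pterm C I J) :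
    peq (PJux PEmpty s) s
| peq_id0r m n (I : m.-tuple 'I_N) (J : n.-tuple 'I_N) (s : pterm C I J) :
    peq (PJux s PEmpty) s.

Lemma peq_labels C N m n m' n' (I : m.-tuple 'I_N) (J : n.-tuple 'I_N)
    (I' : m'.-tuple 'I_N) (J' : n'.-tuple 'I_N)
    (s : pterm C I J) (t : pterm C I' J') :
  peq s t -> val I = val I' /\ val J = val J'.
Proof.
elim=> {m n m' n' I J I' J' s t} //=.
- by move=> m n m' n' I J I' J' s t _ [-> ->].
- by move=> m n m' n' m'' n'' I J I' J' I'' J'' s t r _ [-> ->] _ [-> ->].
- move=> m1 n1 m1' n1' m2 n2 m2' n2' I1 J1 I1' J1' I2 J2 I2' J2' s s' t t'.
  by move=> _ [-> ->] _ [-> ->].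
- by move=> m n k m' n' k' I L J I' L' J' s s' t t' _ [-> _] _ [_ ->].
- by move=> *; rewrite !catA.
- by move=> *; rewrite !cats0.
Qed.

HB.instance Definition _ C N m n (I : m.-tuple 'I_N) (J : n.-tuple 'I_N) :=
  gen_eqMixin (pterm C I J).
HB.instance Definition _ C N m n (I : m.-tuple 'I_N) (J : n.-tuple 'I_N) :=
  gen_choiceMixin (pterm C I J).

Section PathQuotient.
Local Open Scope quotient_scope.
Variables (C : nat -> nat -> finType) (N m n : nat).
Variables (I : m.-tuple 'I_N) (J : n.-tuple 'I_N).

Definition peqb (s t : pterm C I J) : bool := `[< peq s t >].

Lemma peqb_refl : reflexive peqb.
Proof. by move=> s; apply/asboolP; exact: peq_refl. Qed.

Lemma peqb_sym : symmetric peqb.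
Proof. by move=> s t; apply/asboolP/asboolP; exact: peq_sym. Qed.

Lemma peqb_trans : transitive peqb.
Proof.
by move=> t s r /asboolP st /asboolP tr; apply/asboolP; exact: peq_trans st tr.
Qed.

Canonical peq_equiv := EquivRel peqb peqb_refl peqb_sym peqb_trans.

(* [Paths C I J] is the set of the paths q with Out(q) = I and In(q) = J. *)
Definition Paths := {eq_quot peqb}.
HB.instance Definition _ := Choice.on Paths.

Definition path_of (t : pterm C I J) : Paths := \pi_Paths t.
Definition path_repr (q : Paths) : pterm C I J := repr q.

Lemma path_reprK q : path_of (path_repr q) = q.
Proof. exact: reprK. Qed.

Lemma path_ofP s t : path_of s = path_of t <-> peq s t.
Proof. by split=> [/eqmodP/asboolP|st]; last by apply/eqmodP/asboolP. Qed.

Lemma path_reprP t : peq (path_repr (path_of t)) t.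
Proof. by apply/path_ofP; rewrite path_reprK. Qed.

End PathQuotient.

Arguments Paths C {N m n} I J.

Section PathOperations.
Variables (C : nat -> nat -> finType) (N : nat).

Definition path_empty : Paths C ([tuple] : 0.-tuple 'I_N) [tuple] :=
  path_of PEmpty.

Definition path_wire (i : 'I_N) : Paths C [tuple i] [tuple i] :=
  path_of (PWire i).

Definition path_chip n m (I : n.-tuple 'I_N) (c : C n m) (J : m.-tuple 'I_N) :
    Paths C I J :=
  path_of (PChip I c J).

Definition path_jux m n m' n' (I : m.-tuple 'I_N) (J : n.-tuple 'I_N)
    (I' : m'.-tuple 'I_N) (J' : n'.-tuple 'I_N)
    (q : Paths C I J) (q' : Paths C I' J') :
    Paths C (cat_tuple I I') (cat_tuple J J') :=
  path_of (PJux (path_repr q) (path_repr q')).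

Definition path_conn m n k (I : m.-tuple 'I_N) (L : n.-tuple 'I_N)
    (J : k.-tuple 'I_N) (q : Paths C I L) (q' : Paths C L J) : Paths C I J :=
  path_of (PConn (path_repr q) (path_repr q')).

Fixpoint forget_term m n (I : m.-tuple 'I_N) (J : n.-tuple 'I_N)
    (q : pterm C I J) : cterm C m n :=
  match q with
  | PEmpty => CEmpty
  | PWire _ => CWire
  | PChip _ _ _ c _ => CChip c
  | PJux _ _ _ _ _ _ _ _ q1 q2 => CJux (forget_term q1) (forget_term q2)
  | PConn _ _ _ _ _ _ q1 q2 => CConn (forget_term q1) (forget_term q2)
  end.

Lemma forget_pwires n (I : n.-tuple 'I_N) (w : pterm C I I) :
  pwires w -> forget_term w = cid C n.
Proof. by elim=> //= i k L v _ ->. Qed.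

Lemma forget_peq m n m' n' (I : m.-tuple 'I_N) (J : n.-tuple 'I_N)
    (I' : m'.-tuple 'I_N) (J' : n'.-tuple 'I_N)
    (s : pterm C I J) (t : pterm C I' J') :
  peq s t -> ceq (forget_term s) (forget_term t).
Proof.
elim=> {m n m' n' I J I' J' s t} /=.
- by move=> *; exact: ceq_refl.
- by move=> *; exact: ceq_sym.
- by move=> m n m' n' m'' n'' ? ? ? ? ? ? s t r _ st _ tr; exact: ceq_trans st tr.
- by move=> *; exact: ceq_jux.
- by move=> *; exact: ceq_conn.
- by move=> *; exact: ceq_juxA.
- by move=> *; exact: ceq_connA.
- by move=> *; exact: ceq_interchange.
- by move=> m n I J w s /forget_pwires ->; exact: ceq_idl.
- by move=> m n I J s w /forget_pwires ->; exact: ceq_idr.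
- by move=> *; exact: ceq_id0l.
- by move=> *; exact: ceq_id0r.
Qed.

Definition forget m n (I : m.-tuple 'I_N) (J : n.-tuple 'I_N)
    (q : Paths C I J) : Circ C m n :=
  circuit_of (forget_term (path_repr q)).

Lemma forgetE m n (I : m.-tuple 'I_N) (J : n.-tuple 'I_N) (s : pterm C I J) :
  forget (path_of s) = circuit_of (forget_term s).
Proof. exact/circuit_ofP/forget_peq/path_reprP. Qed.

Lemma forget_empty : forget path_empty = idn (Circ C) 0.
Proof. exact: forgetE. Qed.

Lemma forget_wire i : forget (path_wire i) = idn (Circ C) 1.
Proof. by rewrite forgetE circ_wire. Qed.

Lemma forget_chip n m (I : n.-tuple 'I_N) (c : C n m) (J : m.-tuple 'I_N) :
  forget (path_chip I c J) = circ_chip c.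
Proof. exact: forgetE. Qed.

Lemma forget_jux m n m' n' (I : m.-tuple 'I_N) (J : n.-tuple 'I_N)
    (I' : m'.-tuple 'I_N) (J' : n'.-tuple 'I_N)
    (q : Paths C I J) (q' : Paths C I' J') :
  forget (path_jux q q') = jux (forget q) (forget q').
Proof. by rewrite forgetE /= circ_juxE. Qed.

Lemma forget_conn m n k (I : m.-tuple 'I_N) (L : n.-tuple 'I_N)
    (J : k.-tuple 'I_N) (q : Paths C I L) (q' : Paths C L J) :
  forget (path_conn q q') = conn (forget q) (forget q').
Proof. by rewrite forgetE /= circ_connE. Qed.

End PathOperations.

Section PathWeight.
Local Open Scope ring_scope.
Variables (K : comPzSemiRingType) (N : nat) (C : nat -> nat -> finType).
Variable mu : PRO_morphism (Circ C) (Hypermx K N).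

Fixpoint weight_term m n (I : m.-tuple 'I_N) (J : n.-tuple 'I_N)
    (q : pterm C I J) : K :=
  match q with
  | PEmpty => 1
  | PWire _ => 1
  | PChip n m I' c J' => (mu n m (circ_chip c) : hypermx K N n m) I' J'
  | PJux _ _ _ _ _ _ _ _ q1 q2 => weight_term q1 * weight_term q2
  | PConn _ _ _ _ _ _ q1 q2 => weight_term q1 * weight_term q2
  end.

Lemma weight_pwires n (I : n.-tuple 'I_N) (w : pterm C I I) :
  pwires w -> weight_term w = 1.
Proof. by elim=> //= i k L v _ ->; rewrite mulr1. Qed.

Lemma weight_peq m n m' n' (I : m.-tuple 'I_N) (J : n.-tuple 'I_N)
    (I' : m'.-tuple 'I_N) (J' : n'.-tuple 'I_N)
    (s : pterm C I J) (t : pterm C I' J') :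
  peq s t -> weight_term s = weight_term t.
Proof.
elim=> {m n m' n' I J I' J' s t} //=.
- by move=> m n m' n' m'' n'' ? ? ? ? ? ? s t r _ -> _ ->.
- move=> m1 n1 m1' n1' m2 n2 m2' n2' I1 J1 I1' J1' I2 J2 I2' J2' s s' t t'.
  by move=> _ -> _ ->.
- by move=> m n k m' n' k' I L J I' L' J' s s' t t' _ -> _ ->.
- by move=> *; rewrite mulrA.
- by move=> *; rewrite mulrA.
- by move=> *; rewrite mulrACA.
- by move=> m n I J w s /weight_pwires ->; rewrite mul1r.
- by move=> m n I J s w /weight_pwires ->; rewrite mulr1.
- by move=> *; rewrite mul1r.
- by move=> *; rewrite mulr1.
Qed.

Definition path_weight m n (I : m.-tuple 'I_N) (J : n.-tuple 'I_N)
    (q : Paths C I J) : K :=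
  weight_term (path_repr q).

Lemma path_weightE m n (I : m.-tuple 'I_N) (J : n.-tuple 'I_N)
    (s : pterm C I J) :
  path_weight (path_of s) = weight_term s.
Proof. exact/weight_peq/path_reprP. Qed.

Lemma path_weight_empty : path_weight (path_empty C N) = 1.
Proof. exact: path_weightE. Qed.

Lemma path_weight_wire i : path_weight (path_wire C i) = 1.
Proof. exact: path_weightE. Qed.

Lemma path_weight_chip n m (I : n.-tuple 'I_N) (c : C n m)
    (J : m.-tuple 'I_N) :
  path_weight (path_chip I c J) = (mu n m (circ_chip c) : hypermx K N n m) I J.
Proof. exact: path_weightE. Qed.

Lemma path_weight_jux m n m' n' (I : m.-tuple 'I_N) (J : n.-tuple 'I_N)
    (I' : m'.-tuple 'I_N) (J' : n'.-tuple 'I_N)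
    (q : Paths C I J) (q' : Paths C I' J') :
  path_weight (path_jux q q') = path_weight q * path_weight q'.
Proof. exact: path_weightE. Qed.

Lemma path_weight_conn m n k (I : m.-tuple 'I_N) (L : n.-tuple 'I_N)
    (J : k.-tuple 'I_N) (q : Paths C I L) (q' : Paths C L J) :
  path_weight (path_conn q q') = path_weight q * path_weight q'.
Proof. exact: path_weightE. Qed.

End PathWeight.

(* Main.v *)
Require Import Defs.
From mathcomp Require Import all_boot all_algebra.
From mathcomp Require Import boolp classical_sets functions cardinality fsbigop.

(** A circuit is a class of terms, and so is a path; the difficulty is that the
    labels of a path are only visible on terms. Fix a term [s] denoting the
    circuit. Its labellings with given output and input labels form a finite
    type, defined by recursion on [s], in which a connection ranges over all
    label sequences for the joined wires. The sum of the weights of the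
    labelled copies of [s] satisfies the recursion that defines the product of
    hypermatrices, so it is the wanted entry of the representation
    ([sum_labelling]). It remains to see that the labellings of [s] are in
    bijection with the paths over the circuit.

    Every path over the circuit is the class of a labelled copy of [s]
    ([forget_range]): each rule identifying two circuit terms is matched by a
    rule identifying their labelled copies, hence labellings can be carried
    along any chain of rules, in both directions ([lifts_ceq]).

    Distinct labellings of [s] give distinct paths ([labelled_inj]). This is
    where the chips must have outputs: a chip without outputs above a chip
    without inputs is a closed component, two copies of it can be exchanged by
    the rules, and different labellings of the pair then give the same path.
    To separate labellings, a path is unfolded downwards from its outputs into
    a sequence of trees, one for each output: a wire passes on the tree of its
    input, and at each output of a chip there is a node that remembers the
    input labels of the chip and has the trees of its inputs as children. As a
    function of the trees plugged into the inputs this does not depend on the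
    term chosen for the path ([unfold_peq]). Since a chip has an output, its
    node survives above the chip, so for a known term [s] all labels can be
    read off the trees from top to bottom ([unfold_inj_inputs],
    [unfold_inj]). *)

Set Implicit Arguments.
Unset Strict Implicit.
Unset Printing Implicit Defensive.

Import GRing.Theory.

Lemma cat_inj (T : Type) (s1 s2 t1 t2 : seq T) :
  s1 ++ t1 = s2 ++ t2 -> size s1 = size s2 -> s1 = s2 /\ t1 = t2.
Proof.
move=> e sz; split.
  by move/(congr1 (take (size s1))): e; rewrite {2}sz !take_size_cat.
by move/(congr1 (drop (size s1))): e; rewrite {2}sz !drop_size_cat.
Qed.

(** * Labellings of a circuit term *)

Section Labellings.
Variables (C : nat -> nat -> finType) (N : nat).

Definition cast_labels m n (I I' : m.-tuple 'I_N) (J J' : n.-tuple 'I_N)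
    (eI : I = I') (eJ : J = J') (t : pterm C I J) : pterm C I' J' :=
  match eI in _ = A, eJ in _ = B return pterm C A B with erefl, erefl => t end.

(** Only the labels of inner connections are free; a wire admits a labelling
    only when its two ends agree. *)
Fixpoint labelling m n (s : cterm C m n) :
    m.-tuple 'I_N -> n.-tuple 'I_N -> finType :=
  match s in cterm _ m n return m.-tuple 'I_N -> n.-tuple 'I_N -> finType with
  | CEmpty => fun _ _ => unit
  | CWire => fun I J => {_ : unit | I == J}
  | CChip _ _ _ => fun _ _ => unit
  | CJux _ _ _ _ a b => fun I J =>
      (labelling a (ltuple I) (ltuple J) *
       labelling b (rtuple I) (rtuple J))%type
  | CConn _ _ _ a b => fun I J =>
      {L : _.-tuple 'I_N & (labelling a I L * labelling b L J)%type}
  end.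

Lemma thead_tuple1 (I : 1.-tuple 'I_N) : [tuple thead I] = I.
Proof. by apply: val_inj; case: I => [[|i [|? ?]]]. Qed.

Lemma thead_tuple1_eq (I J : 1.-tuple 'I_N) : I == J -> [tuple thead I] = J.
Proof. by move/eqP <-; exact: thead_tuple1. Qed.

Fixpoint labelled m n (s : cterm C m n) :
    forall I J, labelling s I J -> pterm C I J :=
  match s in cterm _ m n
    return forall (I : m.-tuple 'I_N) (J : n.-tuple 'I_N),
      labelling s I J -> pterm C I J with
  | CEmpty => fun I J _ =>
      cast_labels (esym (tuple0 I)) (esym (tuple0 J)) PEmpty
  | CWire => fun I J x =>
      cast_labels (thead_tuple1 I) (thead_tuple1_eq (valP x)) (PWire (thead I))
  | CChip _ _ c => fun I J _ => PChip I c J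
  | CJux _ _ _ _ _ _ => fun I J x =>
      cast_labels (cat_lrtuple I) (cat_lrtuple J)
        (PJux (labelled x.1) (labelled x.2))
  | CConn _ _ _ _ _ => fun I J x =>
      PConn (labelled (tagged x).1) (labelled (tagged x).2)
  end.

Lemma forget_cast m n (I I' : m.-tuple 'I_N) (J J' : n.-tuple 'I_N)
    (eI : I = I') (eJ : J = J') (t : pterm C I J) :
  forget_term (cast_labels eI eJ t) = forget_term t.
Proof. by case: _ / eI; case: _ / eJ. Qed.

Lemma peq_cast m n (I I' : m.-tuple 'I_N) (J J' : n.-tuple 'I_N)
    (eI : I = I') (eJ : J = J') (t : pterm C I J) :
  peq (cast_labels eI eJ t) t.
Proof. by case: _ / eI; case: _ / eJ; exact: peq_refl. Qed.

Lemma forget_labelled m n (s : cterm C m n) I J (x : labelling s I J) :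
  forget_term (labelled x) = s.
Proof.
elim: s I J x => [||k l c|k l k' l' a IHa b IHb|k l h a IHa b IHb] I J x //=;
  by rewrite ?forget_cast //= IHa IHb.
Qed.

(** * Unfolding a path into trees *)

(** The label sequence of a node lists the input labels of a chip. *)
Inductive tree := Node of seq 'I_N & seq tree.

(** All outputs of a chip carry the same tree, because a node stands for a chip
    and is meant to record only its input labels and what lies below it. *)
Fixpoint unfold_term m n (I : m.-tuple 'I_N) (J : n.-tuple 'I_N)
    (t : pterm C I J) (xs : seq tree) : seq tree :=
  match t with
  | PEmpty => xs
  | PWire _ => xs
  | PChip k _ _ _ J' => nseq k (Node J' xs)
  | PJux _ k _ _ _ _ _ _ t1 t2 =>
      unfold_term t1 (take k xs) ++ unfold_term t2 (drop k xs)
  | PConn _ _ _ _ _ _ t1 t2 => unfold_term t1 (unfold_term t2 xs)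
  end.

Lemma size_unfold m n (I : m.-tuple 'I_N) (J : n.-tuple 'I_N)
    (t : pterm C I J) xs :
  size xs = n -> size (unfold_term t xs) = m.
Proof.
elim: t xs => {m n I J} //=.
- by move=> m n I c J xs _; rewrite size_nseq.
- move=> m n m' n' I J I' J' s IHs t IHt xs szx.
  by rewrite size_cat IHs ?IHt ?size_drop ?size_takel ?szx ?addKn ?leq_addr.
- by move=> m n k I L J s IHs t IHt xs szx; rewrite IHs ?IHt.
Qed.

Lemma unfold_pwires n (I : n.-tuple 'I_N) (w : pterm C I I) xs :
  pwires w -> size xs = n -> unfold_term w xs = xs.
Proof.
move=> ww; elim: ww xs => //= i k L v _ IHv [|x xs] //= [szx].
by rewrite take0 drop0 IHv.
Qed.

Lemma unfold_peq m n m' n' (I : m.-tuple 'I_N) (J : n.-tuple 'I_N)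
    (I' : m'.-tuple 'I_N) (J' : n'.-tuple 'I_N)
    (s : pterm C I J) (t : pterm C I' J') xs :
  peq s t -> size xs = n -> unfold_term s xs = unfold_term t xs.
Proof.
move=> st; elim: st xs => {m n m' n' I J I' J' s t} //=.
- move=> m n m' n' I J I' J' s t /peq_labels[_ /(congr1 size)].
  by rewrite !size_tuple => en IH xs szx; rewrite IH // szx en.
- move=> m n m' n' m'' n'' I J I' J' I'' J'' s t r.
  case/peq_labels=> _ /(congr1 size).
  rewrite !size_tuple => en IH1 _ IH2 xs szx.
  by rewrite IH1 // IH2 // szx en.
- move=> m1 n1 m1' n1' m2 n2 m2' n2' I1 J1 I1' J1' I2 J2 I2' J2' s s' t t'.
  case/peq_labels=> _ /(congr1 size).
  rewrite !size_tuple => en IH1 _ IH2 xs szx.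
  have [<- <-] : take n1 xs = take n1' xs /\ drop n1 xs = drop n1' xs.
    by rewrite en.
  by rewrite IH1 ?IH2 ?size_drop ?size_takel ?szx ?addKn ?leq_addr.
- move=> m n k m' n' k' I L J I' L' J' s s' t t' _ IH1 _ IH2 xs szx.
  by rewrite -IH2 // IH1 // size_unfold.
- move=> m1 n1 m2 n2 m3 n3 I1 J1 I2 J2 I3 J3 s t r xs szx.
  by rewrite catA take_takel ?leq_addr // take_drop drop_drop ![n2 + n1]addnC.
- move=> m n k m' n' k' I L J I' L' J' s t s' t' xs szx.
  have sz1 : size (unfold_term t (take k xs)) = n.
    by rewrite size_unfold // size_takel // szx leq_addr.
  by rewrite take_size_cat // drop_size_cat.
- by move=> m n I J w s ww xs szx; rewrite unfold_pwires // size_unfold.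
- by move=> m n I J s w ww xs szx; rewrite unfold_pwires.
- by move=> m n I J s xs szx; rewrite take0 drop0.
- move=> m n I J s xs; rewrite addn0 => szx.
  by rewrite take_oversize ?drop_oversize ?cats0 ?szx.
Qed.

Lemma unfold_cast m n (I I' : m.-tuple 'I_N) (J J' : n.-tuple 'I_N)
    (eI : I = I') (eJ : J = J') (t : pterm C I J) xs :
  unfold_term (cast_labels eI eJ t) xs = unfold_term t xs.
Proof. by case: _ / eI; case: _ / eJ. Qed.

(** The input labels and the plugged trees can be read off the unfolding
    because every input is reached from some output: descending from an
    output, a chip is met at one of its outputs. The output labels [I] must be
    common to both sides, as a bare wire leaves no trace in the trees. *)
Lemma unfold_inj_inputs (C_gt0 : forall n m, C n m -> (0 < n)%N) m n
    (s : cterm C m n) I J J'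
    (x : labelling s I J) (x' : labelling s I J') xs xs' :
  size xs = n -> size xs' = n ->
  unfold_term (labelled x) xs = unfold_term (labelled x') xs' ->
  J = J' /\ xs = xs'.
Proof.
elim: s I J J' x x' xs xs' => [||k l c|k l k' l' a IHa b IHb|k l h a IHa b IHb]
  /= I J J' x x' xs xs' szx szx'.
- by rewrite !unfold_cast /= => ->; rewrite (tuple0 J) (tuple0 J').
- by rewrite !unfold_cast /= => ->; case: x x' => [_ /eqP<-] [_ /eqP<-].
- by case: k c (C_gt0 _ _ c) {x x'} I => //= k c _ I [/val_inj-> ->].
- rewrite !unfold_cast /= => /cat_inj[|/IHa ea /IHb eb].
    by rewrite !size_unfold // size_takel ?szx ?szx' ?leq_addr.
  have [||eJ ex] := ea; rewrite ?size_takel ?szx ?szx' ?leq_addr //.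
  have [||eJ' ex'] := eb; rewrite ?size_drop ?szx ?szx' ?addKn //.
  split; first by rewrite -(cat_lrtuple J) eJ eJ' cat_lrtuple.
  by rewrite -(cat_take_drop l xs) ex ex' cat_take_drop.
- case: x x' => [L [xa xb]] [L' [xa' xb']] /=.
  move=> /IHa[||eL]; rewrite ?size_unfold //.
  by subst L' => /IHb; exact.
Qed.

(** At a connection, the previous lemma gives equality of the hidden labels and
    of the trees passed between the two parts, so that both parts can be
    treated separately. *)
Lemma unfold_inj (C_gt0 : forall n m, C n m -> (0 < n)%N) m n
    (s : cterm C m n) I J (x x' : labelling s I J) xs xs' :
  size xs = n -> size xs' = n ->
  unfold_term (labelled x) xs = unfold_term (labelled x') xs' -> x = x'.
Proof.
elim: s I J x x' xs xs' => [||k l c|k l k' l' a IHa b IHb|k l h a IHa b IHb]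
  /= I J x x' xs xs' szx szx'.
- by case: x x' => [] [].
- by move=> _; apply: val_inj; case: (val x) (val x') => [] [].
- by case: x x' => [] [].
- case: x x' => [xa xb] [xa' xb'].
  rewrite !unfold_cast /= => /cat_inj[|/IHa ea /IHb eb].
    by rewrite !size_unfold // size_takel ?szx ?szx' ?leq_addr.
  by rewrite ea ?eb // ?size_takel ?size_drop ?szx ?szx' ?leq_addr ?addKn.
- case: x x' => [L [xa xb]] [L' [xa' xb']] /= exx.
  have [||eL exb] := unfold_inj_inputs C_gt0 _ _ exx; rewrite ?size_unfold //.
  subst L'.
  by rewrite (IHa _ _ _ _ _ _ _ _ exx) ?(IHb _ _ _ _ _ _ _ _ exb) ?size_unfold.
Qed.

Lemma labelled_inj (C_gt0 : forall n m, C n m -> (0 < n)%N) m n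
    (s : cterm C m n) I J :
  injective (fun x : labelling s I J => path_of (labelled x)).
Proof.
(* Any trees can be plugged into the inputs. *)
move=> x x' /path_ofP.
move/(@unfold_peq _ _ _ _ _ _ _ _ _ _ (nseq n (Node [::] [::]))).
by rewrite size_nseq => /(_ erefl)/(unfold_inj C_gt0)->; rewrite ?size_nseq.
Qed.

(** * Carrying labellings along the rules *)

(** The path denoted by [t] has a labelled copy of [s] as representative. The
    degrees and labels of [t] are independent of those of [s], so that the
    statement makes sense along the rules, which relate terms of different
    degrees. *)
Definition over m n m' n' (s : cterm C m n) (I' : m'.-tuple 'I_N)
    (J' : n'.-tuple 'I_N) (t : pterm C I' J') : Prop :=
  exists I J (x : labelling s I J), peq (labelled x) t.

Lemma over_peq m n m1 n1 m2 n2 (s : cterm C m n)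
    (I1 : m1.-tuple 'I_N) (J1 : n1.-tuple 'I_N)
    (I2 : m2.-tuple 'I_N) (J2 : n2.-tuple 'I_N)
    (t : pterm C I1 J1) (u : pterm C I2 J2) :
  peq t u -> over s t -> over s u.
Proof.
by move=> tu [I [J [x xt]]]; exists I, J, x; exact: peq_trans xt tu.
Qed.

Lemma over_labelled m n (s : cterm C m n) I J (x : labelling s I J) :
  over s (labelled x).
Proof. by exists I, J, x; exact: peq_refl. Qed.

Lemma over_labelling m n (s : cterm C m n) I J (t : pterm C I J) :
  over s t -> exists x : labelling s I J, peq (labelled x) t.
Proof.
case=> I' [J' [x xt]]; have [/val_inj eI /val_inj eJ] := peq_labels xt.
by subst I' J'; exists x.
Qed.

Lemma over_jux m n m' n' (a : cterm C m n) (b : cterm C m' n')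
    m1 n1 m2 n2 (I1 : m1.-tuple 'I_N) (J1 : n1.-tuple 'I_N)
    (I2 : m2.-tuple 'I_N) (J2 : n2.-tuple 'I_N)
    (t : pterm C I1 J1) (u : pterm C I2 J2) :
  over a t -> over b u -> over (CJux a b) (PJux t u).
Proof.
move=> [I [J [x xt]]] [I' [J' [y yu]]].
have [x' xx'] : exists x' : labelling a (ltuple (cat_tuple I I'))
    (ltuple (cat_tuple J J')), peq (labelled x') t.
  by rewrite !ltuple_cat; exists x.
have [y' yy'] : exists y' : labelling b (rtuple (cat_tuple I I'))
    (rtuple (cat_tuple J J')), peq (labelled y') u.
  by rewrite !rtuple_cat; exists y.
exists (cat_tuple I I'), (cat_tuple J J'), (x', y').
exact: peq_trans (peq_cast _ _ _) (peq_jux xx' yy').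
Qed.

Lemma over_conn m n k (a : cterm C m n) (b : cterm C n k)
    m' n' k' (I : m'.-tuple 'I_N) (L : n'.-tuple 'I_N) (J : k'.-tuple 'I_N)
    (t : pterm C I L) (u : pterm C L J) :
  over a t -> over b u -> over (CConn a b) (PConn t u).
Proof.
move=> [I' [L1 [x xt]]] [L2 [J' [y yu]]].
have eL : L1 = L2.
  by apply: val_inj; have [_ ->] := peq_labels xt; have [-> _] := peq_labels yu.
subst L2; exists I', J', (existT _ L1 (x, y)).
exact: peq_conn xt yu.
Qed.

Lemma over_forget m n (I : m.-tuple 'I_N) (J : n.-tuple 'I_N)
    (t : pterm C I J) :
  over (forget_term t) t.
Proof.
elim: t => {m n I J} /=.
- by exists [tuple], [tuple], tt; exact: peq_cast.
- move=> i; exists [tuple i], [tuple i], (exist _ tt (eqxx _)).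
  exact: peq_cast.
- by move=> n m I c J; exists I, J, tt; exact: peq_refl.
- by move=> *; exact: over_jux.
- by move=> *; exact: over_conn.
Qed.

Lemma pwires_exist n (I : n.-tuple 'I_N) : exists w : pterm C I I, pwires w.
Proof.
elim: n I => [|n IHn] I.
  by rewrite (tuple0 I); exists PEmpty; exact: pwires0.
case/tupleP: I => i I; have [w ww] := IHn I.
have e : cat_tuple [tuple i] I = [tuple of i :: I] by exact: val_inj.
by case: _ / e; exists (PJux (PWire i) w); exact: pwiresS.
Qed.

Lemma over_cid n (I : n.-tuple 'I_N) (w : pterm C I I) :
  pwires w -> over (Defs.cid C n) w.
Proof. by move/forget_pwires <-; exact: over_forget. Qed.

(** The rules for vertical units speak of juxtapositions of labelled wires; this
    makes them applicable to labelled copies of the unit term. *)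
Lemma labelled_cid n I J (w : labelling (Defs.cid C n) I J) :
  exists L (v : pterm C L L), @pwires C N n L v /\ peq (labelled w) v.
Proof.
elim: n I J w => [|n IHn] I J /= w.
  by exists [tuple], PEmpty; split; [exact: pwires0|exact: peq_cast].
case: w => w1 w; have [L [v [vv wv]]] := IHn _ _ w.
set i := thead (@ltuple _ 1 n I).
exists (cat_tuple [tuple i] L), (PJux (PWire i) v); split; first exact: pwiresS.
have w1v : peq (@labelled _ _ CWire _ _ w1) (PWire i).
  exact: peq_cast.
have wwv := peq_jux w1v wv.
exact: (peq_trans (@peq_cast (1 + n) (1 + n) _ _ _ _ _ _ _) wwv).
Qed.

Lemma peq_cid_l m n I L (J : n.-tuple 'I_N) (w : labelling (Defs.cid C m) I L)
    (t : pterm C L J) :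
  peq (PConn (labelled w) t) t.
Proof.
have [M [v [vv wv]]] := labelled_cid w.
have [/val_inj eI /val_inj eL] := peq_labels wv; subst I L.
exact: peq_trans (peq_conn wv (peq_refl t)) (peq_idl t vv).
Qed.

Lemma peq_cid_r m n (I : m.-tuple 'I_N) L J (t : pterm C I L)
    (w : labelling (Defs.cid C n) L J) :
  peq (PConn t (labelled w)) t.
Proof.
have [M [v [vv wv]]] := labelled_cid w.
have [/val_inj eL /val_inj eJ] := peq_labels wv; subst L J.
exact: peq_trans (peq_conn (peq_refl t) wv) (peq_idr t vv).
Qed.

Definition lifts m n m' n' (s : cterm C m n) (s' : cterm C m' n') : Prop :=
  forall I J (x : labelling s I J), over s' (labelled x).

Lemma liftsP m n m' n' (s : cterm C m n) (s' : cterm C m' n') p q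
    (I : p.-tuple 'I_N) (J : q.-tuple 'I_N) (t : pterm C I J) :
  lifts s s' -> over s t -> over s' t.
Proof. by move=> ss' [I' [J' [x xt]]]; exact: over_peq xt (ss' _ _ x). Qed.

Lemma lifts_jux m n m' n' (a : cterm C m n) (b : cterm C m' n') p q
    (s : cterm C p q) :
  (forall I J I' J' (x : labelling a I J) (y : labelling b I' J'),
    over s (PJux (labelled x) (labelled y))) ->
  lifts (CJux a b) s.
Proof.
by move=> h I J x; apply: over_peq (h _ _ _ _ x.1 x.2); exact/peq_sym/peq_cast.
Qed.

Lemma lifts_conn m n k (a : cterm C m n) (b : cterm C n k) p q
    (s : cterm C p q) :
  (forall I L J (x : labelling a I L) (y : labelling b L J),
    over s (PConn (labelled x) (labelled y))) ->
  lifts (CConn a b) s.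
Proof. by move=> h I J [L [x y]]; exact: h. Qed.

(** For associativity, units of juxtaposition and interchange, a labelling of
    one side is regrouped into one of the other, the corresponding rule for
    paths showing that the path is unchanged. A labelling of a connection with
    a unit term loses its unit; conversely the unit is given the labels at the
    place where it is inserted. *)
Lemma lifts_ceq m n m' n' (s : cterm C m n) (s' : cterm C m' n') :
  ceq s s' -> lifts s s' /\ lifts s' s.
Proof.
elim=> {m n m' n' s s'}.
- by move=> m n s; split=> I J x; exact: over_labelled.
- by move=> m n m' n' s t _ [].
- move=> m n m' n' m'' n'' s t r _ [st ts] _ [tr rt].
  by split=> I J x; [exact: liftsP tr (st _ _ x)|exact: liftsP ts (rt _ _ x)].
- move=> m1 n1 m1' n1' m2 n2 m2' n2' s s' t t' _ [ss' s's] _ [tt' t't].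
  by split; apply: lifts_jux => *; apply: over_jux; auto.
- move=> m n k m' n' k' s s' t t' _ [ss' s's] _ [tt' t't].
  by split; apply: lifts_conn => *; apply: over_conn; auto.
- move=> m1 n1 m2 n2 m3 n3 s t r; split; apply: lifts_jux => I J I' J'.
    move=> x yz; apply: over_peq (peq_jux (peq_refl _) _) _.
      exact/peq_sym/peq_cast.
    apply: over_peq (peq_sym (peq_juxA _ _ _)) _.
    by do 2![apply: over_jux; try exact: over_labelled].
  move=> xy z; apply: over_peq (peq_jux _ (peq_refl _)) _.
    exact/peq_sym/peq_cast.
  apply: over_peq (peq_juxA _ _ _) _.
  by do 2![apply: over_jux; try exact: over_labelled].
- move=> m n k l s t r; split; apply: lifts_conn => I L J.
    move=> x [M [y z]]; apply: over_peq (peq_sym (peq_connA _ _ _)) _.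
    by do 2![apply: over_conn; try exact: over_labelled].
  move=> [M [x y]] z; apply: over_peq (peq_connA _ _ _) _.
  by do 2![apply: over_conn; try exact: over_labelled].
- move=> m n k m' n' k' s t s' t'; split.
    apply: lifts_jux => I J I' J' [L [x y]] [L' [x' y']].
    apply: over_peq (peq_sym (peq_interchange _ _ _ _)) _.
    by apply: over_conn; apply: over_jux; exact: over_labelled.
  apply: lifts_conn => I L J xx yy.
  (* The casts identify the middle labels with a concatenation, which makes
     the interchange rule applicable. *)
  apply: over_peq (peq_conn (peq_sym (peq_cast _ _ _))
                            (peq_sym (peq_cast _ _ _))) _.
  apply: over_peq (peq_interchange _ _ _ _) _.
  by apply: over_jux; apply: over_conn; exact: over_labelled.
- move=> m n s; split.
    apply: lifts_conn => I L J w x.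
    exact: over_peq (peq_sym (peq_cid_l _ _)) (over_labelled _).
  move=> I J x; have [w ww] := pwires_exist I.
  apply: over_peq (peq_idl _ ww) _.
  exact: over_conn (over_cid ww) (over_labelled _).
- move=> m n s; split.
    apply: lifts_conn => I L J x w.
    exact: over_peq (peq_sym (peq_cid_r _ _)) (over_labelled _).
  move=> I J x; have [w ww] := pwires_exist J.
  apply: over_peq (peq_idr _ ww) _.
  exact: over_conn (over_labelled _) (over_cid ww).
- move=> m n s; split.
    apply: lifts_jux => I J I' J' e x.
    apply: over_peq (peq_jux (peq_sym (peq_cast _ _ _)) (peq_refl _)) _.
    apply: over_peq (peq_sym (peq_id0l _)) _.
    exact: over_labelled.
  move=> I J x; apply: over_peq (peq_id0l _) _.
  apply: over_jux (over_labelled _); exact: (@over_forget _ _ _ _ PEmpty).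
- move=> m n s; split.
    apply: lifts_jux => I J I' J' x e.
    apply: over_peq (peq_jux (peq_refl _) (peq_sym (peq_cast _ _ _))) _.
    apply: over_peq (peq_sym (peq_id0r _)) _.
    exact: over_labelled.
  move=> I J x; apply: over_peq (peq_id0r _) _.
  apply: over_jux (over_labelled _) _; exact: (@over_forget _ _ _ _ PEmpty).
Qed.

Lemma forget_range m n (s : cterm C m n) I J :
  ([set q : Paths C I J | forget q = circuit_of s] =
  range (fun x : labelling s I J => path_of (labelled x)))%classic.
Proof.
apply/seteqP; split=> [q|q [x _ <-]] /=; last first.
  by rewrite forgetE forget_labelled.
rewrite -{1}(path_reprK q) forgetE => /circuit_ofP/lifts_ceq[fs _].
have [x xq] := over_labelling (liftsP fs (over_forget (path_repr q))).
by exists x => //; rewrite -(path_reprK q); apply/path_ofP.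
Qed.

End Labellings.

(** * Summation over labellings *)

Section Weights.
Local Open Scope ring_scope.
Variables (K : comPzSemiRingType) (N : nat) (C : nat -> nat -> finType).
Variable mu : PRO_morphism (Circ C) (Hypermx K N).

Lemma weight_cast m n (I I' : m.-tuple 'I_N) (J J' : n.-tuple 'I_N)
    (eI : I = I') (eJ : J = J') (t : pterm C I J) :
  weight_term mu (cast_labels eI eJ t) = weight_term mu t.
Proof. by case: _ / eI; case: _ / eJ. Qed.

Lemma sum_labelling m n (s : cterm C m n) (I : m.-tuple 'I_N)
    (J : n.-tuple 'I_N) :
  (mu m n (circuit_of s) : hypermx K N m n) I J =
    \sum_(x : labelling s I J) weight_term mu (labelled x).
Proof.
elim: s I J => [||k l c|k l k' l' a IHa b IHb|k l h a IHa b IHb] /= I J.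
- rewrite (pro_fun_id mu 0) /= !ffunE (tuple0 I) (tuple0 J) eqxx.
  by rewrite (big_pred1 tt) ?weight_cast // => [[]].
- rewrite circ_wire (pro_fun_id mu 1) /= !ffunE.
  have /orP[eIJ|neIJ] := orbN (I == J).
    rewrite [LHS](_ : _ = 1) ?eIJ // (big_pred1 (exist _ tt eIJ)) => [|x].
      by rewrite weight_cast.
    by apply/esym/eqP/val_inj; case: (val x).
  rewrite [LHS](_ : _ = 0) ?(negbTE neIJ) // big_pred0 // => x.
  by case/negP: neIJ; exact: valP x.
- by rewrite (big_pred1 tt) // => [[]].
- rewrite -circ_juxE (pro_fun_jux mu) /= !ffunE IHa IHb big_distrlr pair_big /=.
  by apply: eq_bigr => x _; rewrite weight_cast.
- rewrite -circ_connE (pro_fun_conn mu) /= !ffunE.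
  transitivity (\sum_(L : l.-tuple 'I_N)
      \sum_(x : (labelling a I L * labelling b L J)%type)
         weight_term mu (labelled x.1) * weight_term mu (labelled x.2)).
    by apply: eq_bigr => L _; rewrite IHa IHb big_distrlr pair_big.
  by rewrite sig_big_dep.
Qed.

End Weights.

Local Open Scope classical_set_scope.
Local Open Scope ring_scope.

Theorem proposition7 (K : comPzSemiRingType) (N : nat) (N_gt0 : (0 < N)%N)
    (C : nat -> nat -> finType)
    (C_gt0 : forall n m : nat, C n m -> (0 < n)%N /\ (0 < m)%N)
    (mu : PRO_morphism (Circ C) (Hypermx K N))
    (m n : nat) (p : Circ C m n) (I : m.-tuple 'I_N) (J : n.-tuple 'I_N) :
  finite_set [set q : Paths C I J | forget q = p] /\
  (mu m n p : hypermx K N m n) I J =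
    \sum_(q \in [set q : Paths C I J | forget q = p]) path_weight mu q.
Proof.
rewrite -(circuit_reprK p) forget_range; split.
  exact/finite_image/finite_finset.
have C_out k l (c : C k l) : (0 < k)%N by case: (C_gt0 _ _ c).
rewrite fsbig_image; last by move=> x y _ _ /(labelled_inj C_out).
(* The sum over a set becomes one over the enumeration of the labellings. *)
rewrite [X in \sum_(_ \in X) _](_ : _ = [set` index_enum _]).
  rewrite -fsbig_seq ?index_enum_uniq // sum_labelling.
  by apply: eq_bigr => x _; rewrite path_weightE.
by apply/seteqP; split=> // x _; exact: mem_index_enum.
Qed.
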